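(* There are no fuzzy implications that are simultaneously $QL$-implication functions and $(\mathcal{GO},N)$-implication functions.
   Context: A fuzzy negation is a map $N:[0,1]\to[0,1]$ with $N(0)=1$, $N(1)=0$ and $N(x)\le N(y)$ whenever $y\le x$. A bivariate general overlap function is a function $\mathcal{GO}:[0,1]^2\to[0,1]$ such that for all $x,y\in[0,1]$: (1) $\mathcal{GO}(x,y)=\mathcal{GO}(y,x)$; (2) if $xy=0$ then $\mathcal{GO}(x,y)=0$; (3) if $xy=1$ then $\mathcal{GO}(x,y)=1$; (4) $\mathcal{GO}$ is increasing (in the non-strict sense) in each variable; (5) $\mathcal{GO}$ is continuous. An overlap function is a function $O:[0,1]^2\to[0,1]$ that is commutative, continuous, increasing (in the non-strict sense) in each variable, and satisfies $O(x,y)=0$ if and only if $x=0$ or $y=0$, and $O(x,y)=1$ if and only if $x=y=1$. A grouping function is a function $G:[0,1]^2\to[0,1]$ that is commutative, continuous, increasing (in the non-strict sense) in each variable, and satisfies $G(x,y)=0$ if and only if $x=y=0$, and $G(x,y)=1$ if and only if $x=1$ or $y=1$. A fuzzy implication is a function $I:[0,1]^2\to[0,1]$ such that for all $x,y,z\in[0,1]$: $x\le z$ implies $I(x,y)\ge I(z,y)$; $y\le z$ implies $I(x,y)\le I(x,z)$; $I(0,y)=1$; $I(x,1)=1$; $I(1,0)=0$. A $(\mathcal{GO},N)$-implication is a function $I$ for which there exist a bivariate general overlap function $\mathcal{GO}$ and a fuzzy negation $N$ with $I(x,y)=N(\mathcal{GO}(x,N(y)))$ for all $x,y\in[0,1]$.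 A $QL$-implication is a function $I$ for which there exist an overlap function $O$ and a grouping function $G$ such that $I(1,y)=G(0,O(1,y))$ for all $y\in[0,1]$ and $I(x,y)=1$ for all $x\in[0,1)$, $y\in[0,1]$. *)

(* Defs.v *)
From HB Require Import structures.
From mathcomp Require Import all_boot all_order all_algebra.
From mathcomp Require Import all_classical all_reals all_analysis.

Set Implicit Arguments.
Unset Strict Implicit.
Unset Printing Implicit Defensive.

Import Order.TTheory GRing.Theory Num.Theory.
Import numFieldNormedType.Exports.

Local Open Scope classical_set_scope.
Local Open Scope ring_scope.

(* A map [0,1] -> [0,1] (resp. [0,1]^2 -> [0,1]) is encoded as a total function
   R -> R (resp. R -> R -> R) of which only the values on [0,1] (resp. [0,1]^2)
   are ever constrained or used. *)

Definition unit_map (R : realType) (f : R -> R) : Prop :=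
  forall x, x \in `[0, 1] -> f x \in `[0, 1].

Definition unit_op (R : realType) (F : R -> R -> R) : Prop :=
  forall x y, x \in `[0, 1] -> y \in `[0, 1] -> F x y \in `[0, 1].

Definition commutative01 (R : realType) (F : R -> R -> R) : Prop :=
  forall x y, x \in `[0, 1] -> y \in `[0, 1] -> F x y = F y x.

Definition increasing01 (R : realType) (F : R -> R -> R) : Prop :=
  (forall x y z, x \in `[0, 1] -> y \in `[0, 1] -> z \in `[0, 1] ->
     x <= z -> F x y <= F z y) /\
  (forall x y z, x \in `[0, 1] -> y \in `[0, 1] -> z \in `[0, 1] ->
     y <= z -> F x y <= F x z).

(* Joint continuity, for the subspace topology of [0,1]^2. *)
Definition continuous01 (R : realType) (F : R -> R -> R) : Prop :=
  {within (`[0, 1] : set R) `*` (`[0, 1] : set R),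
    continuous (fun p : R * R => F p.1 p.2)}.

Record fuzzy_negation (R : realType) (N : R -> R) : Prop := {
  fneg_unit : unit_map N;
  fneg0 : N 0 = 1;
  fneg1 : N 1 = 0;
  fneg_anti : forall x y, x \in `[0, 1] -> y \in `[0, 1] ->
    y <= x -> N x <= N y }.

Record general_overlap (R : realType) (GO : R -> R -> R) : Prop := {
  gov_unit : unit_op GO;
  gov_comm : commutative01 GO;
  gov0 : forall x y, x \in `[0, 1] -> y \in `[0, 1] ->
    x * y = 0 -> GO x y = 0;
  gov1 : forall x y, x \in `[0, 1] -> y \in `[0, 1] ->
    x * y = 1 -> GO x y = 1;
  gov_incr : increasing01 GO;
  gov_cont : continuous01 GO }.

Record overlap (R : realType) (O : R -> R -> R) : Prop := {
  ov_unit : unit_op O;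
  ov_comm : commutative01 O;
  ov_cont : continuous01 O;
  ov_incr : increasing01 O;
  ov0 : forall x y, x \in `[0, 1] -> y \in `[0, 1] ->
    (O x y = 0 <-> x = 0 \/ y = 0);
  ov1 : forall x y, x \in `[0, 1] -> y \in `[0, 1] ->
    (O x y = 1 <-> x = 1 /\ y = 1) }.

Record grouping (R : realType) (G : R -> R -> R) : Prop := {
  gr_unit : unit_op G;
  gr_comm : commutative01 G;
  gr_cont : continuous01 G;
  gr_incr : increasing01 G;
  gr0 : forall x y, x \in `[0, 1] -> y \in `[0, 1] ->
    (G x y = 0 <-> x = 0 /\ y = 0);
  gr1 : forall x y, x \in `[0, 1] -> y \in `[0, 1] ->
    (G x y = 1 <-> x = 1 \/ y = 1) }.

Record fuzzy_implication (R : realType) (I : R -> R -> R) : Prop := {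
  fimp_unit : unit_op I;
  fimp_antil : forall x y z,
    x \in `[0, 1] -> y \in `[0, 1] -> z \in `[0, 1] ->
    x <= z -> I x y >= I z y;
  fimp_monor : forall x y z,
    x \in `[0, 1] -> y \in `[0, 1] -> z \in `[0, 1] ->
    y <= z -> I x y <= I x z;
  fimp0l : forall y, y \in `[0, 1] -> I 0 y = 1;
  fimp1r : forall x, x \in `[0, 1] -> I x 1 = 1;
  fimp10 : I 1 0 = 0 }.

Definition GON_implication (R : realType) (I : R -> R -> R) : Prop :=
  exists (GO : R -> R -> R) (N : R -> R),
    [/\ general_overlap GO, fuzzy_negation N &
        forall x y, x \in `[0, 1] -> y \in `[0, 1] ->
          I x y = N (GO x (N y))].

Definition QL_implication (R : realType) (I : R -> R -> R) : Prop :=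
  exists (O G : R -> R -> R),
    [/\ overlap O, grouping G,
        forall y, y \in `[0, 1] -> I 1 y = G 0 (O 1 y) &
        forall x y, x \in `[0, 1[ -> y \in `[0, 1] -> I x y = 1].

(* Main.v *)
Require Import Defs.
From mathcomp Require Import all_boot all_order all_algebra.
From mathcomp Require Import all_classical all_reals all_analysis.

(** Both descriptions of [I] are compared through the negation [N].  A
    QL-implication equals [1] whenever its first argument is below [1]; since
    [N 0 = 1], this reads [N (GO x 1) = 1] for [x < 1].  As [x] runs through
    [[0, 1]], [GO x 1] goes continuously from [0] to [1], so by the
    intermediate value theorem every [t < 1] is [GO x 1] for some [x < 1]:
    hence [N] is [1] below [1] and [0] at [1]
    ([GON_crisp_negation]).  A (GO,N)-implication with such an [N] takes no
    value other than [0] and [1].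

    But [I 1 (1/2) = G 0 (O 1 (1/2))] lies strictly between [0] and [1],
    because overlap and grouping functions attain [0] and [1] only at the
    points prescribed by their definitions
    ([grouping_overlap_inner]). *)

Import Order.TTheory GRing.Theory Num.Theory.
Import numFieldNormedType.Exports.

Local Open Scope classical_set_scope.
Local Open Scope ring_scope.

Lemma zero_in01 (R : realType) : (0 : R) \in `[0, 1].
Proof. by rewrite in_itv /= lexx ler01. Qed.

Lemma one_in01 (R : realType) : (1 : R) \in `[0, 1].
Proof. by rewrite in_itv /= lexx ler01. Qed.

Lemma continuous01_section {R : realType} {F : R -> R -> R} {b : R} :
  b \in `[0, 1] -> continuous01 F ->
  {within `[0, 1], continuous (fun x => F x b)}.
Proof.
move=> b01 /subspace_continuousP cF; apply/subspace_continuousP => x x01.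
apply: cvg_trans (cF (x, b) (conj x01 b01)) => /=.
(* If a product [U * V] meets the square inside [A], then pulling back along
   [y |-> (y, b)] shows that [U] suffices on the segment. *)
move=> A [[U V] [/= xU bV] UVA]; apply: filterS xU => y Uy y01.
by apply: (UVA (y, b)); split => //=; exact: nbhs_singleton bV.
Qed.

Lemma general_overlap_onto {R : realType} {GO : R -> R -> R} {t : R} :
  general_overlap GO -> t \in `[0, 1] ->
  exists2 x, x \in `[0, 1] & GO x 1 = t.
Proof.
move=> hGO t01; have [i0 i1] := (zero_in01 R, one_in01 R).
apply: IVT => //; first exact: continuous01_section (gov_cont hGO).
rewrite (gov0 hGO) ?mul0r // (gov1 hGO) ?mul1r //.
by rewrite min_l ?max_r ?ler01 //; move: t01; rewrite in_itv.
Qed.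

(** Evaluating at [y = 0] suffices: [N 0 = 1] turns the condition on [I] into
    one on [N (GO x 1)], and [x |-> GO x 1] is onto [[0, 1]]. *)
Lemma GON_crisp_negation {R : realType} {I GO : R -> R -> R} {N : R -> R} :
  general_overlap GO -> fuzzy_negation N ->
  (forall x y, x \in `[0, 1] -> y \in `[0, 1] -> I x y = N (GO x (N y))) ->
  (forall x y, x \in `[0, 1[ -> y \in `[0, 1] -> I x y = 1) ->
  forall t, t \in `[0, 1] -> t != 1 -> N t = 1.
Proof.
move=> hGO hN IE I1 t t01 t1; have [i0 i1] := (zero_in01 R, one_in01 R).
have [x x01 xt] := general_overlap_onto hGO t01.
have x1 : x != 1.
  by apply: contra_neq t1 => x1; rewrite -xt x1 (gov1 hGO) ?mul1r.
have x_lt1 : x \in `[0, 1[.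
  by move: x01; rewrite !in_itv /= => /andP[-> xle1]; rewrite lt_neqAle x1.
by have := IE x 0 x01 i0; rewrite I1 // (fneg0 hN) xt.
Qed.

Lemma grouping_overlap_inner {R : realType} {O G : R -> R -> R} {y : R} :
  overlap O -> grouping G -> y \in `]0, 1[ ->
  G 0 (O 1 y) <> 0 /\ G 0 (O 1 y) <> 1.
Proof.
move=> hO hG; rewrite in_itv /= => /andP[y_gt0 y_lt1].
have [i0 i1] := (zero_in01 R, one_in01 R).
have y01 : y \in `[0, 1] by rewrite in_itv /= !ltW.
have O01 := ov_unit hO i1 y01.
split.
- move/(gr0 hG i0 O01) => [_ /(ov0 hO i1 y01)[/eqP|y0]].
    by rewrite oner_eq0.
  by rewrite y0 ltxx in y_gt0.
- move/(gr1 hG i0 O01) => [/esym/eqP|/(ov1 hO i1 y01)[_ y1]].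
    by rewrite oner_eq0.
  by rewrite y1 ltxx in y_lt1.
Qed.

Theorem proposition24 (R : realType) :
  ~ exists I : R -> R -> R,
      [/\ fuzzy_implication I, QL_implication I & GON_implication I].
Proof.
move=> [I [_ [Ovl [G [hO hG I1E I1]]] [GO [N [hGO hN IE]]]]].
have i1 := one_in01 R.
have half_in : (2^-1 : R) \in `]0, 1[.
  by rewrite in_itv /= invr_gt0 ltr0n invf_lt1 ?ltr0n // ltr1n.
have half01 : (2^-1 : R) \in `[0, 1] by exact: subset_itv_oo_cc half_in.
have [] := grouping_overlap_inner hO hG half_in; rewrite -I1E // IE //.
have [->|t1] := eqVneq (GO 1 (N 2^-1)) 1; first by rewrite (fneg1 hN).
move=> _; apply; apply: (GON_crisp_negation hGO hN IE I1) t1.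
exact: (gov_unit hGO i1 (fneg_unit hN half01)).
Qed.
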